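(* Let $G=(V,E,w)$ be a finite undirected loopless graph with $n$ vertices and nonnegative edge weights $w_e\ge0$ ($e\in E$). For every integer $k$ with $1\le k<n/2$, $$\lambda_{\max}\bigl(Q(F_k(G))\bigr)\le\lambda_{\max}\bigl(Q(F_{k+1}(G))\bigr),$$ $$\lambda_{\max}\bigl(A(F_k(G))\bigr)\le\lambda_{\max}\bigl(A(F_{k+1}(G))\bigr),$$ where $A(F_k(G))$ and $Q(F_k(G))$ denote the weighted adjacency matrix and the weighted signless Laplacian of the $k$-token graph $F_k(G)$.
   Context: Edges of $G$ are two-element subsets $\{i,j\}$ of $V$. No connectedness is assumed, and zero weights are allowed. For $0\le k\le n$, the weighted $k$-token graph $F_k(G)$ has vertex set $\binom{V}{k}=\{S\subseteq V:|S|=k\}$. Its weighted adjacency matrix $A(F_k(G))=A_k$, indexed by $\binom Vk$, has entries $(A_k)_{S,T}=w_{\{i,j\}}$ if the symmetric difference $S\triangle T=\{i,j\}$ is an edge in $E$, and $(A_k)_{S,T}=0$ otherwise. Its weighted degree matrix is $D_k=\operatorname{diag}(d_k(S):S\in\binom Vk)$ with $d_k(S)=\sum_{e\in E,\ |S\cap e|=1}w_e$. The signless Laplacian is $Q(F_k(G))=D_k+A_k$. $\lambda_{\max}(M)$ denotes the largest eigenvalue of a real symmetric matrix $M$. *)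

(* Defs.v *)
From HB Require Import structures.
From mathcomp Require Import all_boot all_order all_algebra.
From mathcomp Require Import classical_sets reals.

Set Implicit Arguments.
Unset Strict Implicit.
Unset Printing Implicit Defensive.

Import Order.TTheory GRing.Theory Num.Theory.
Local Open Scope ring_scope.

(* Values of [weight] outside [edges] are unconstrained and never used. *)
Record wgraph (R : realType) (V : finType) := WGraph {
  edges : {set {set V}};
  weight : {set V} -> R;
  edges_card2 : forall e, e \in edges -> #|e| = 2%N;
  weight_ge0 : forall e, e \in edges -> 0 <= weight e
}.

(* Rows and columns of the token-graph matrices are indexed by ordinals
   through [enum_val : 'I_#|ksubsets V k| -> {set V}]. *)
Definition ksubsets (V : finType) (k : nat) : {set {set V}} :=
  [set S : {set V} | #|S| == k].

Definition symdiff (V : finType) (S T : {set V}) : {set V} :=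
  (S :\: T) :|: (T :\: S).

Section TokenGraph.
Variables (R : realType) (V : finType) (G : wgraph R V) (k : nat).

Definition token_adj : 'M[R]_#|ksubsets V k| :=
  \matrix_(i, j)
    let e := symdiff (enum_val i) (enum_val j) in
    if e \in edges G then weight G e else 0.

Definition token_deg (S : {set V}) : R :=
  \sum_(e in edges G | #|S :&: e| == 1%N) weight G e.

Definition token_degmx : 'M[R]_#|ksubsets V k| :=
  diag_mx (\row_i token_deg (enum_val i)).

Definition token_signless : 'M[R]_#|ksubsets V k| := token_degmx + token_adj.

End TokenGraph.

(* For a real symmetric matrix of positive size the set of eigenvalues is
   finite and nonempty, so this supremum is its maximum. *)
Definition lambda_max (R : realType) (m : nat) (M : 'M[R]_m) : R :=
  sup [set a : R | eigenvalue M a]%classic.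

(* Main.v *)
(* On functions of S, a subset of V, consider for an edge e = {i, j} the
   swap operator (exchange i and j) and the pair operator, which sends f to
   the function equal to f(S) + f(S symdiff e) if S separates i and j and to 0
   otherwise. Then Q is the sum of w_e pair_e, and A is the sum of
   w_e (pair_e + swap_e) / 2 minus a constant, with the same constant for all k.
   Both operators map the indicator of the sets splitting every pair of a partial
   matching of V (encoded by an involution) to a nonnegative multiple of another
   such indicator. Hence powers of the shifted operators send the constant 1 into
   the cone spanned by these indicators. A set of size k < n/2 splitting a
   matching contains fewer than half of the unmatched vertices, so such an
   indicator has a larger sum on the (k+1)-sets than on the k-sets. Therefore
   the sum of the entries of the t-th power of the shifted matrix is
   nondecreasing from k to k + 1 for every t, and its exponential growth rate
   in t is governed by the largest eigenvalue. *)
Require Import Defs.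
From HB Require Import structures.
From mathcomp Require Import all_boot all_order all_algebra all_fingroup.
From mathcomp Require Import classical_sets reals complex.
From mathcomp Require Import ring lra zify.

Set Implicit Arguments.
Unset Strict Implicit.
Unset Printing Implicit Defensive.

Import Order.TTheory GRing.Theory Num.Theory.
Local Open Scope ring_scope.

(** * Comparing largest eigenvalues through walk sums *)

(* [c i] is [|<u_i, 1>|^2] for an orthonormal eigenbasis [u_i] of [M] over [R[i]]. *)
Lemma spectral_walk_sum (R : realType) (m : nat) (M : 'M[R]_m) :
  M^T = M ->
  exists (d c : 'I_m -> R),
    [/\ forall i, eigenvalue M (d i),
        forall a, eigenvalue M a -> exists i, a = d i,
        forall i, 0 <= c i &
        forall x t, \sum_i \sum_j ((M + x%:M) ^+ t) i j =
                    \sum_i c i * (d i + x) ^+ t].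
Proof.
move=> Msym; pose iota := real_complex R.
pose MC := map_mx iota M.
have MCh : MC \is hermsymmx.
  apply: realsym_hermsym.
    apply/is_hermitianmxP; rewrite expr0 scale1r map_mx_id //.
    by apply/matrixP => i j; rewrite !mxE -[in LHS]Msym mxE.
  by apply/mxOverP => i j; rewrite mxE; apply/complex_realP; exists (M i j).
have Dreal := hermitian_spectral_diag_real MCh.
have /hermitian_normalmx /orthomx_spectralP := MCh.
have Pu := spectral_unit MC; have PU := spectral_unitarymx MC.
move: Dreal Pu PU; set P := spectralmx MC; set D := spectral_diag MC.
move=> Dreal Pu PU MCE.
pose d i := complex.Re (D 0 i).
have dE i : iota (d i) = D 0 i by apply: RRe_real; exact: (mxOverP Dreal).
pose q i : R[i] := \sum_j P i j.
pose c i := complex.Re (`|q i| ^+ 2).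
have cE i : iota (c i) = `|q i| ^+ 2 by apply: RRe_real; rewrite rpredX // normr_real.
clearbody c d.
have PMC : P *m MC = diag_mx D *m P by rewrite MCE !mulmxA mulmxV // mul1mx.
(* Eigenvalues are the roots of the characteristic polynomial, so a real number may be tested over
   [R[i]]. *)
have eigE a : eigenvalue M a = eigenvalue MC (iota a).
  by rewrite !eigenvalue_root_char -map_char_poly fmorph_root.
exists d, c; split.
- move=> i; rewrite eigE dE; apply/eigenvalueP; exists (row i P).
    rewrite -row_mul PMC; apply/rowP => j; rewrite mul_diag_mx !mxE.
    by [].
  apply: contraTneq Pu => Pi0; rewrite unitmxE (expand_det_row _ i).
  rewrite big1 ?unitr0 // => j _; have /rowP/(_ j) := Pi0; rewrite !mxE => ->.
  by rewrite mul0r.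
- move=> a; rewrite eigE => /eigenvalueP[v vM v0].
  (* [u] holds the coordinates of [v] in the eigenbasis; wherever [u] is nonzero, the diagonal entry
     must equal [a]. *)
  pose u := v *m invmx P.
  have u0 : u != 0.
    by apply: contraNneq v0 => u0; rewrite -[v](mulmxKV Pu) -/u u0 mul0mx.
  have [i ui] := rV0Pn _ u0.
  exists i; apply: (@complexI R); rewrite -[RHS]/(iota _) dE.
  have : u *m diag_mx D = iota a *: u.
    by rewrite /u scalemxAl -vM MCE !mulmxA mulmxK.
  move/rowP/(_ i); rewrite mul_mx_diag [LHS]mxE [RHS]mxE mulrC.
  by move/(mulIf ui).
- by move=> i; rewrite -ler0c -/(iota _) cE exprn_ge0.
move=> x t; apply: (@complexI R).
have pw : map_mx iota ((M + x%:M) ^+ t) =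
   invmx P *m diag_mx (\row_i (D 0 i + iota x) ^+ t) *m P.
  elim: t => [|t IH].
    rewrite !expr0 map_mx1; apply: (canRL (mulmxKV Pu)).
    rewrite mul1mx -[LHS]mulmx1; congr (_ *m _).
    by apply/matrixP => i j; rewrite !mxE expr0.
  rewrite exprS map_mxM IH map_mxD map_scalar_mx -/MC.
  rewrite !mulmxA; congr (_ *m _).
  have -> : MC + (iota x)%:M = invmx P *m (diag_mx D + (iota x)%:M) *m P.
    rewrite mulmxDr mulmxDl -MCE; congr (_ + _).
    by rewrite mul_mx_scalar -scalemxAl mulVmx // scalemx1.
  rewrite mulmxK // -mulmxA; congr (_ *m _).
  rewrite -diag_const_mx -raddfD mulmx_diag; congr diag_mx.
  by apply/rowP => i; rewrite !mxE exprS.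
transitivity (\sum_i \sum_j (map_mx iota ((M + x%:M) ^+ t)) i j).
  rewrite (rmorph_sum iota); apply: eq_bigr => i _.
  by rewrite (rmorph_sum iota); apply: eq_bigr => j _; rewrite [RHS]mxE.
rewrite (rmorph_sum iota) pw invmx_unitary //.
transitivity (\sum_i \sum_j \sum_l (P l i)^* * (D 0 l + iota x) ^+ t * P l j).
  apply: eq_bigr => i _; apply: eq_bigr => j _.
  by rewrite mxE; apply: eq_bigr => l _; rewrite mul_mx_diag !mxE.
under eq_bigr => i _ do rewrite exchange_big /=.
rewrite exchange_big /=; apply: eq_bigr => l _.
transitivity (`|q l| ^+ 2 * (D 0 l + iota x) ^+ t); last first.
  by rewrite -cE -dE (rmorphM iota) (rmorphXn iota) (rmorphD iota).
rewrite normCK; move: (_ ^+ t) => X.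
transitivity (q l * X * (q l)^*); last by ring.
rewrite [(q l)^*]rmorph_sum mulr_sumr; apply: eq_bigr => i _.
by rewrite -mulr_sumr -/(q l) /=; ring.
Qed.

(** A left eigenvector satisfies [a^t |v_j| <= sum_i |v_i| (M^t)_ij]. Sum over [j], bound each
    [|v_i|] by the l1 norm [B] of [v], and cancel [B]. *)
Lemma eigenvalue_le_walk_sum (R : realType) (m : nat) (M : 'M[R]_m) (a : R) (t : nat) :
  (forall i j, 0 <= M i j) -> eigenvalue M a -> 0 <= a ->
  a ^+ t <= \sum_i \sum_j (M ^+ t) i j.
Proof.
move=> M0 /eigenvalueP[v vM v0] a0.
have Mt0 : forall i j, 0 <= (M ^+ t) i j.
  elim: t => [|t IH] i j; first by rewrite expr0 mxE; case: eqP.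
  by rewrite exprS mxE sumr_ge0 // => l _; rewrite mulr_ge0.
have vMt : v *m M ^+ t = a ^+ t *: v.
  elim: t {Mt0} => [|t IH]; first by rewrite !expr0 mulmx1 scale1r.
  by rewrite exprS mulmxA vM -scalemxAl IH scalerA -exprS.
pose B := \sum_j `|v 0 j|.
have vB i : `|v 0 i| <= B by rewrite /B (bigD1 i) //= lerDl sumr_ge0.
have [i vi] := rV0Pn _ v0.
have B0 : 0 < B by apply: lt_le_trans (vB i); rewrite normr_gt0.
rewrite -(ler_pM2r B0) [in leLHS]/B mulr_sumr exchange_big mulr_suml.
apply: ler_sum => j _.
have /rowP/(_ j) := vMt; rewrite [LHS]mxE [RHS]mxE => /(congr1 Num.norm).
rewrite normrM (ger0_norm (exprn_ge0 t a0)) => <-.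
rewrite (le_trans (ler_norm_sum _ _ _)) // mulr_suml ler_sum // => l _.
by rewrite normrM (ger0_norm (Mt0 _ _)) mulrC ler_wpM2l.
Qed.

(** If [x > y], Bernoulli's inequality makes [(x / y)^t] grow at least linearly in [t], so no
    constant bounds it. *)
Lemma le_of_exprn_le_mul (R : realType) (C x y : R) :
  0 < y -> (forall t, x ^+ t <= C * y ^+ t) -> x <= y.
Proof.
move=> y0 H; rewrite leNgt; apply/negP => yx.
have Ct t : (x / y) ^+ t <= C by rewrite expr_div_n ler_pdivrMr ?exprn_gt0.
pose h := x / y - 1.
have h0 : 0 < h by rewrite subr_gt0 ltr_pdivlMr // mul1r.
have bern t : 1 + t%:R * h <= (x / y) ^+ t.
  elim: t => [|t IH]; first by rewrite mul0r addr0 expr0.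
  rewrite exprS -natr1; move: IH; move: (_ ^+ t) => X IH.
  have -> : x / y = 1 + h by rewrite addrC subrK.
  have h1 : 0 <= h * (X - (1 + t%:R * h)).
    by apply: mulr_ge0; [exact: ltW | rewrite subr_ge0].
  have h2 : 0 <= t%:R * h ^+ 2 by rewrite mulr_ge0 ?sqr_ge0 ?ler0n.
  by nra.
have C0 : 0 <= C / h by rewrite divr_ge0 ?(ltW h0) // (le_trans _ (Ct 0%N)) ?expr0.
have := archi_boundP C0; set n := Num.bound _; rewrite ltr_pdivrMr //.
by have := le_trans (bern n) (Ct n); lra.
Qed.

(** For an eigenvalue [a] of [M], [(a + x)^t] is at most the walk sum of [M], hence that of [M'],
    which the spectral formula bounds by a constant times [(lambda_max M' + x)^t]. Comparing growth
    in [t] gives the claim. *)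
Lemma lambda_max_le_walk_sum (R : realType) (m m' : nat)
    (M : 'M[R]_m) (M' : 'M[R]_m') (s : R) :
  (0 < m)%N -> (0 < m')%N -> M^T = M -> M'^T = M' ->
  (forall x, s <= x -> forall i j, 0 <= (M + x%:M) i j) ->
  (forall x t, s <= x -> \sum_i \sum_j ((M + x%:M) ^+ t) i j <=
                         \sum_i \sum_j ((M' + x%:M) ^+ t) i j) ->
  lambda_max M <= lambda_max M'.
Proof.
move=> m0 m'0 Msym M'sym M0 le_walk.
have [d [_ [Md _ _ _]]] := spectral_walk_sum Msym.
have [d' [c' [M'd dM' c'0 walkM']]] := spectral_walk_sum M'sym.
apply: ge_sup => [|a Ma]; first by exists (d (Ordinal m0)); exact: Md.
set L := lambda_max M'; pose B := \sum_i `|d' i|.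
have d'B i : `|d' i| <= B by rewrite /B (bigD1 i) //= lerDl sumr_ge0.
have d'L i : d' i <= L.
  apply: ub_le_sup; last exact: M'd.
  by exists B => b /dM'[j ->]; rewrite (le_trans (ler_norm _)).
(* One shift that is at least [s] and makes [a + x] and all [d' i + x] nonnegative and [L + x]
   positive. *)
pose x := `|s| + `|L| + `|a| + B + 1.
have B0 : 0 <= B by rewrite sumr_ge0.
have sL := ler_norm s; have LL := lerNnormlW (lexx `|L|).
have aa := lerNnormlW (lexx `|a|).
have [s0 [L0 a0]] : 0 <= `|s| /\ 0 <= `|L| /\ 0 <= `|a| by rewrite !normr_ge0.
have sx : s <= x by rewrite /x; lra.
rewrite -(lerD2r x); apply: (@le_of_exprn_le_mul _ (\sum_i c' i)) => [|t].
  by rewrite /x; lra.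
apply: le_trans (eigenvalue_le_walk_sum t (M0 x sx) _ _) _.
- have /eigenvalueP[v vM v0] := Ma.
  apply/eigenvalueP; exists v => //.
  by rewrite mulmxDr vM mul_mx_scalar [RHS]scalerDl.
- by rewrite /x; lra.
apply: le_trans (le_walk x t sx) _.
rewrite walkM' mulr_suml; apply: ler_sum => i _.
have dB := lerNnormlW (d'B i).
rewrite ler_wpM2l // lerXn2r ?nnegrE ?lerD2r //.
  by rewrite /x; lra.
by rewrite /x; lra.
Qed.

(** * Matchings, the sets that split them, and the pair operator *)

Definition splits (V : finType) (mu : {perm V}) (S : {set V}) : bool :=
  [forall v, (mu v != v) ==> ((v \in S) != (mu v \in S))].

(** Conjugation relabels the matching. Every new matching below arises this way, except when two
    unmatched vertices get joined. *)
Lemma splits_conj (V : finType) (mu s : {perm V}) (S : {set V}) :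
  splits (mu ^ s)%g S = splits mu (s @^-1: S).
Proof.
apply/forallP/forallP => H v.
  by have := H (s v); rewrite permJ !inE (inj_eq perm_inj).
have := H ((s^-1)%g v).
by rewrite -[X in (mu ^ s)%g X](permKV s) permJ !inE permKV -(inj_eq (@perm_inj _ s)) permKV.
Qed.

Lemma conj_tperm_orbit (V : finType) (mu : {perm V}) (i : V) :
  involutive mu -> (mu ^ tperm i (mu i))%g = mu.
Proof.
move=> muK; apply/permP => v.
rewrite -[v](tpermK i (mu i)) permJ.
case: (tpermP i (mu i) v) => [_|_|vi vmi].
- by rewrite muK tpermL tpermR.
- by rewrite tpermR tpermL.
have mvi : mu v != i by apply/eqP => mvi; apply: vmi; rewrite -mvi muK.
have mvmi : mu v != mu i by apply/eqP => /perm_inj.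
by rewrite tpermD // 1?eq_sym // tpermD // eq_sym; apply/eqP.
Qed.

Lemma splits_tperm_orbit (V : finType) (mu : {perm V}) (i : V) (S : {set V}) :
  involutive mu -> splits mu (tperm i (mu i) @^-1: S) = splits mu S.
Proof. by move=> muK; rewrite -splits_conj conj_tperm_orbit. Qed.

Lemma card_setI2_eq1 (V : finType) (i j : V) (S : {set V}) : i != j ->
  (#|S :&: [set i; j]| == 1%N) = ((i \in S) != (j \in S)).
Proof.
move=> ij; rewrite -sum1_card.
rewrite (eq_bigl (fun v => (v \in [set i; j]) && (v \in S))); last first.
  by move=> v; rewrite !inE andbC.
rewrite big_mkcondr /= big_setU1 ?inE //= big_set1.
by case: (i \in S); case: (j \in S).
Qed.

Lemma symdiff_set2 (V : finType) (i j : V) (S : {set V}) :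
  (i \in S) != (j \in S) -> symdiff S [set i; j] = tperm i j @^-1: S.
Proof.
move=> Sij; apply/setP => v; rewrite !inE.
case: tpermP => [->|->|/eqP vi /eqP vj].
- by move: Sij; rewrite eqxx /=; case: (i \in S); case: (j \in S).
- by move: Sij; rewrite eqxx orbT /=; case: (i \in S); case: (j \in S).
by rewrite (negPf vi) (negPf vj) /= andbF orbF.
Qed.

Lemma splitsN (V : finType) (mu : {perm V}) (i : V) (S : {set V}) :
  mu i != i -> (i \in S) = (mu i \in S) -> splits mu S = false.
Proof. by move=> mui iS; apply/forallP => /(_ i); rewrite mui iS eqxx. Qed.

(** The partner [a] of [i] lies either on the side of [j] or on the side of [i]. In the first case
    only [S] can split [mu], in the second only the swapped set. Conjugating by [tperm a j] makes
    [j] the new partner of [i] and hands the old partner of [j], if any, to [a]. *)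
Lemma pair_splits_partner (V : finType) (mu : {perm V}) (i j : V) (S : {set V}) :
  involutive mu -> i != j -> mu i != i -> mu i != j ->
  (if (i \in S) != (j \in S)
   then splits mu S + splits mu (tperm i j @^-1: S) else 0)%N
  = splits (mu ^ tperm (mu i) j)%g S.
Proof.
move=> muK ij; set a := mu i => ai aj.
rewrite splits_conj; case: ifPn => [Sij|]; last first.
  rewrite negbK => /eqP Sij; rewrite (@splitsN _ _ i) // !inE -/a tpermL -Sij.
  by rewrite tpermD // eq_sym.
have [Saj|] := eqVneq (a \in S) (j \in S).
  have -> : tperm a j @^-1: S = S.
    by apply/setP => v; rewrite inE; case: tpermP => // ->.
  have -> : splits mu (tperm i j @^-1: S) = false; last by rewrite addn0.
  by apply: (@splitsN _ _ i) => //; rewrite !inE -/a tpermL tpermD // 1?eq_sym.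
move=> Saj; have Sai : (i \in S) = (a \in S).
  by move: Sij Saj; case: (i \in S); case: (a \in S); case: (j \in S).
(* Swapping the partners [i] and [a] preserves [mu]; after that swap the two preimages coincide,
   since [i] and [a] are on the same side of [S]. *)
rewrite (@splitsN _ _ i) // add0n -(splits_tperm_orbit i _ muK) -/a.
congr (nat_of_bool (splits _ _)); apply/setP => v; rewrite !inE.
have [->|va] := eqVneq v a; first by rewrite tpermR !tpermL.
have [->|vi] := eqVneq v i.
  by rewrite tpermL (@tpermD _ i j a) 1?eq_sym // tpermD // eq_sym.
have [->|vj] := eqVneq v j.
  by rewrite (@tpermD _ i a j) // !tpermR.
by rewrite (@tpermD _ i a v) 1?eq_sym // tpermD 1?eq_sym // tpermD // eq_sym.
Qed.

(* The cup-cap operator on [{i, j}] joins [i] to [j] and the former partners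
   of [i] and [j] to each other; a closed loop contributes the factor 2. *)
Lemma pair_splits (V : finType) (mu : {perm V}) (i j : V) :
  involutive mu -> i != j ->
  exists (nu : {perm V}) (g : nat), involutive nu /\
    forall S : {set V},
      (if (i \in S) != (j \in S)
       then splits mu S + splits mu (tperm i j @^-1: S) else 0)%N
      = (g * splits nu S)%N.
Proof.
move=> muK ij.
have conjK s : involutive (mu ^ s)%g.
  by move=> v; rewrite -[v](permKV s) !permJ muK.
(* If [i] and [j] are partners, the swap preserves [mu], so both summands agree: this is the closed
   loop. *)
have [mui|mui] := eqVneq (mu i) j.
  exists mu, 2%N; split=> // S; rewrite -mui splits_tperm_orbit //.
  case: ifPn => [_|]; first by rewrite mul2n addnn.
  by rewrite negbK => /eqP Sij; rewrite (@splitsN _ _ i) // mui eq_sym.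
have [mui'|mui'] := eqVneq (mu i) i; last first.
  by exists (mu ^ tperm (mu i) j)%g, 1%N; split=> [|S]; [exact: conjK | rewrite mul1n; exact: pair_splits_partner].
have [muj|muj] := eqVneq (mu j) j; last first.
  exists (mu ^ tperm (mu j) i)%g, 1%N; split; first exact: conjK.
  move=> S; rewrite mul1n tpermC eq_sym; apply: pair_splits_partner => //.
    by rewrite eq_sym.
  by apply: contraNneq muj => mujE; rewrite -(inj_eq (@perm_inj _ mu)) muK mujE -[j]muK mujE mui'.
(* Now [i] and [j] are both unmatched. The swap again preserves [mu], which gives the factor 2, and
   the new matching gains the pair of [i] and [j]. *)
have mu_tperm v : mu (tperm i j v) = tperm i j (mu v).
  case: tpermP => [->|->|vi vj]; rewrite ?mui' ?muj ?tpermL ?tpermR //.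
  by rewrite tpermD //; apply/eqP => E; [apply: vi | apply: vj];
     rewrite -[v]muK -E ?mui' ?muj.
exists (mu * tperm i j)%g, 2%N; split.
  by move=> v; rewrite !permM mu_tperm tpermK muK.
have muC : (mu ^ tperm i j)%g = mu.
  by apply/permP => v; rewrite -[in LHS](tpermK i j v) permJ -mu_tperm tpermK.
move=> S; rewrite -splits_conj muC.
case: ifPn => [Sij|]; last first.
  rewrite negbK => /eqP Sij; rewrite (@splitsN _ _ i) // permM mui' tpermL //.
  by rewrite eq_sym.
rewrite mul2n addnn; congr (_.*2); congr nat_of_bool.
apply/forallP/forallP => H v.
  rewrite permM; case: tpermP => [E|E|vi vj]; last exact: H.
    have -> : v = i by rewrite -[v]muK E mui'.
    by apply/implyP.
  have -> : v = j by rewrite -[v]muK E muj.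
  by apply/implyP => _; rewrite eq_sym.
have [->|vi] := eqVneq v i; first by rewrite mui' eqxx.
have [->|vj] := eqVneq v j; first by rewrite muj eqxx.
have := H v; rewrite permM tpermD //; apply/eqP => E.
  by rewrite -[v]muK -E mui' eqxx in vi.
by rewrite -[v]muK -E muj eqxx in vj.
Qed.

(** * Counting splitting sets of a given size *)

(** [S] takes exactly one vertex of each matched pair, so its size determines how many unmatched
    vertices it contains. The identity is doubled to avoid halving. *)
Lemma card_splits_fixed (V : finType) (mu : {perm V}) (S : {set V}) :
  involutive mu -> splits mu S ->
  (2 * #|[set v | mu v == v] :&: S| + #|V| = #|[set v | mu v == v]| + 2 * #|S|)%N.
Proof.
move=> muK /forallP Smu; set F := [set v | mu v == v].
have Fmu v : (mu v \in F) = (v \in F).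
  by rewrite !inE muK eq_sym.
have mvS v : v \notin F -> (mu v \in S) = (v \notin S).
  by move=> vF; have := Smu v; rewrite inE in vF; rewrite vF; case: (v \in S); case: (mu v \in S).
have SF : #|S :\: F| = #|~: F :\: S|.
  rewrite -(card_imset _ (@perm_inj _ mu)); apply: eq_card => v.
  apply/imsetP/idP => [[u]|].
    by rewrite finset.in_setD => /andP[uF uS] ->; rewrite finset.in_setD finset.in_setC Fmu mvS // uF uS.
  rewrite finset.in_setD finset.in_setC => /andP[vS vF]; exists (mu v); last by rewrite muK.
  by rewrite finset.in_setD Fmu vF mvS.
have := cardsID F S; have := cardsID S (~: F); have := cardsC F.
rewrite SF [S :&: F]finset.setIC.
have -> : #|~: F :&: S| = #|S :\: F| by rewrite finset.setIC finset.setDE.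
by rewrite SF; lia.
Qed.

Lemma splits_setU1 (V : finType) (mu : {perm V}) (v : V) (S : {set V}) :
  involutive mu -> mu v = v -> splits mu (v |: S) = splits mu S.
Proof.
move=> muK muv; apply: eq_forallb => u.
rewrite !inE; have [->|uv] := eqVneq u v; first by rewrite muv eqxx.
suff /negPf -> : mu u != v by [].
by apply: contra uv => /eqP E; rewrite -[u]muK E muv.
Qed.

(* Count in two ways the pairs (S, S + v) of splitting sets of sizes k and
   k + 1; their difference v is a fixed point of [mu]. *)
Lemma card_splits_le (V : finType) (mu : {perm V}) (k : nat) :
  involutive mu -> (2 * k < #|V|)%N ->
  (#|[set S in ksubsets V k | splits mu S]| <=
   #|[set S in ksubsets V k.+1 | splits mu S]|)%N.
Proof.
move=> muK kV; set A := [set S in _ | _]; set A' := [set S in _ | _].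
pose F := [set v | mu v == v].
have [->|[S0 S0A]] := set_0Vmem A; first by rewrite cards0.
have AE S : S \in A -> #|S| = k /\ splits mu S.
  by rewrite !inE => /andP[/eqP].
have A'E S : S \in A' -> #|S| = k.+1 /\ splits mu S.
  by rewrite !inE => /andP[/eqP].
have [S0k S0s] := AE _ S0A; have S0F := card_splits_fixed muK S0s.
(* Every splitting [k]-set contains exactly [b] fixed points, and every splitting [k.+1]-set [b.+1].
   As [2 * k < #|V|] forces [2 * b < #|F|], a [k]-set misses at least [b.+1] of them. *)
pose b := #|F :&: S0|.
have upA S : S \in A -> (b.+1 <= #|F :\: S|)%N.
  move=> /AE[Sk Ss]; have := card_splits_fixed muK Ss.
  have := cardsID S F; rewrite -/F /b in S0F *; lia.
have downA S : S \in A' -> #|F :&: S| = b.+1.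
  move=> /A'E[Sk Ss]; have := card_splits_fixed muK Ss; rewrite -/F /b in S0F *; lia.
have dc : (\sum_(S in A) #|F :\: S| = \sum_(S in A') #|F :&: S|)%N.
  transitivity (\sum_(S in A) \sum_(v in F | v \notin S) 1)%N.
    apply: eq_bigr => S _; rewrite -sum1_card; apply: eq_bigl => v.
    by rewrite finset.in_setD andbC.
  transitivity (\sum_(S in A') \sum_(v in F | v \in S) 1)%N; last first.
    apply: eq_bigr => S _; rewrite -sum1_card; apply: eq_bigl => v.
    by rewrite finset.in_setI.
  rewrite (exchange_big_dep (mem F)) /=; last by move=> S v _ /andP[].
  rewrite [RHS](exchange_big_dep (mem F)) /=; last by move=> S v _ /andP[].
  apply: eq_bigr => v vF; have muv : mu v = v by move: vF; rewrite inE => /eqP.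
  rewrite [RHS](reindex_onto (fun S => v |: S) (fun S => S :\ v)) /=; last first.
    by move=> S /andP[_ /andP[_ vS]]; rewrite finset.setD1K.
  apply: eq_bigl => S; rewrite vF !inE eqxx /= andbT splits_setU1 //.
  rewrite cardsU1; case: (boolP (v \in S)) => vS /=.
    rewrite andbF; apply/esym/negP => /andP[_ /eqP E].
    by move: vS; rewrite -E !inE eqxx.
  by rewrite finset.setU1K // eqxx !andbT.
rewrite -(@leq_pmul2r b.+1) // -!sum_nat_const.
rewrite (leq_trans (leq_sum _ upA)) // dc.
by rewrite (eq_bigr (fun=> b.+1)).
Qed.

(** * The cone of splitting indicators and its invariance *)

Definition pair_op (R : realType) (V : finType) (e : {set V})
    (f : {set V} -> R) (S : {set V}) : R :=
  if #|S :&: e| == 1%N then f S + f (symdiff S e) else 0.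

Definition swap_op (R : realType) (V : finType) (e : {set V})
    (f : {set V} -> R) (S : {set V}) : R :=
  if #|S :&: e| == 1%N then f (symdiff S e) else f S.

(** Nonnegative combinations of splitting indicators. The equations are pointwise, so no functional
    extensionality is needed. *)
Inductive split_cone (R : realType) (V : finType) : ({set V} -> R) -> Prop :=
| SplitConeGen (mu : {perm V}) (c : R) (f : {set V} -> R) :
    involutive mu -> 0 <= c -> (forall S, f S = c * (splits mu S)%:R) ->
    split_cone f
| SplitConeAdd (f g h : {set V} -> R) :
    split_cone f -> split_cone g -> (forall S, h S = f S + g S) ->
    split_cone h.

Lemma split_cone_const (R : realType) (V : finType) (c : R) :
  0 <= c -> split_cone (fun _ : {set V} => c).
Proof.
move=> c0; apply: (@SplitConeGen _ _ 1%g c) => // [v|S]; first by rewrite !perm1.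
rewrite (_ : splits 1 S = true) ?mulr1 //.
by apply/forallP => v; rewrite perm1 eqxx.
Qed.

Lemma split_cone_ext (R : realType) (V : finType) (f g : {set V} -> R) :
  split_cone f -> f =1 g -> split_cone g.
Proof.
move=> Cf fg; apply: SplitConeAdd Cf (split_cone_const _ (lexx 0)) _ => S.
by rewrite addr0 fg.
Qed.

Lemma split_cone_scale (R : realType) (V : finType) (c : R) (f : {set V} -> R) :
  0 <= c -> split_cone f -> split_cone (fun S => c * f S).
Proof.
move=> c0; elim=> {f} [mu b f muK b0 fE|f g h _ Cf _ Cg hE].
  by apply: (@SplitConeGen _ _ mu (c * b)) => // [|S]; rewrite ?mulr_ge0 // fE mulrA.
by apply: SplitConeAdd Cf Cg _ => S; rewrite hE mulrDr.
Qed.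

Lemma split_cone_sum (R : realType) (V : finType) (I : Type) (r : seq I)
    (P : pred I) (F : I -> {set V} -> R) :
  (forall i, P i -> split_cone (F i)) ->
  split_cone (fun S => \sum_(i <- r | P i) F i S).
Proof.
move=> CF; elim: r => [|i r IH].
  by apply: split_cone_ext (split_cone_const _ (lexx 0)) _ => S; rewrite big_nil.
have [Pi|nPi] := boolP (P i).
  by apply: SplitConeAdd (CF i Pi) IH _ => S; rewrite big_cons Pi.
by apply: split_cone_ext IH _ => S; rewrite big_cons (negPf nPi).
Qed.

Lemma split_cone_pair (R : realType) (V : finType) (e : {set V}) (f : {set V} -> R) :
  #|e| = 2%N -> split_cone f -> split_cone (pair_op e f).
Proof.
move=> /eqP/cards2P[i [j [ij ->]]]; elim=> {f} [mu c f muK c0 fE|f g h _ Cf _ Cg hE].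
  have [nu [g [nuK H]]] := pair_splits muK ij.
  apply: (@SplitConeGen _ _ nu (c * g%:R)) => // [|S]; first by rewrite mulr_ge0 ?ler0n.
  rewrite -mulrA -natrM -H /pair_op card_setI2_eq1 //.
  by case: ifPn => [Sij|_]; rewrite ?mulr0 // symdiff_set2 // !fE natrD mulrDr.
apply: SplitConeAdd Cf Cg _ => S; rewrite /pair_op; case: ifP; rewrite ?addr0 // !hE.
by rewrite addrACA.
Qed.

Lemma split_cone_swap (R : realType) (V : finType) (e : {set V}) (f : {set V} -> R) :
  #|e| = 2%N -> split_cone f -> split_cone (swap_op e f).
Proof.
move=> /eqP/cards2P[i [j [ij ->]]]; elim=> {f} [mu c f muK c0 fE|f g h _ Cf _ Cg hE].
  apply: (@SplitConeGen _ _ (mu ^ tperm i j)%g c) => // [v|S].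
    by rewrite -[v](permKV (tperm i j)) !permJ muK.
  rewrite /swap_op card_setI2_eq1 // splits_conj !fE.
  case: ifPn => [Sij|]; first by rewrite symdiff_set2.
  rewrite negbK => /eqP Sij; congr (_ * (nat_of_bool (splits _ _))%:R); apply/setP => v.
  by rewrite inE; case: tpermP => [->|->|].
by apply: SplitConeAdd Cf Cg _ => S; rewrite /swap_op; case: ifP; rewrite !hE.
Qed.

Lemma split_cone_level_le (R : realType) (V : finType) (k : nat) (f : {set V} -> R) :
  (2 * k < #|V|)%N -> split_cone f ->
  \sum_(S in ksubsets V k) f S <= \sum_(S in ksubsets V k.+1) f S.
Proof.
move=> kV; elim=> {f} [mu c f muK c0 fE|f g h _ Cf _ Cg hE]; last first.
  by under eq_bigr do rewrite hE; under [leRHS]eq_bigr do rewrite hE;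
     rewrite !big_split lerD.
have sumE l : \sum_(S in ksubsets V l) f S =
              c * #|[set S in ksubsets V l | splits mu S]|%:R.
  rewrite (eq_bigr _ (fun S _ => fE S)) -mulr_sumr -sum1_card natr_sum; congr (_ * _).
  rewrite [RHS](eq_bigl (fun S => (S \in ksubsets V l) && splits mu S)); last first.
    by move=> S; rewrite inE.
  by rewrite big_mkcondr; apply: eq_bigr => S _; case: (splits mu S).
by rewrite !sumE ler_wpM2l // ler_nat card_splits_le.
Qed.

(** * Token-graph matrices as operators on set functions *)

(** A common form, independent of [k], for the shifted signless Laplacian ([a = 1], [b = 0]) and the
    shifted adjacency matrix ([a = b = 1/2]). *)
Definition token_op (R : realType) (V : finType) (G : wgraph R V) (c a b : R)
    (f : {set V} -> R) (S : {set V}) : R :=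
  c * f S +
  \sum_(e in edges G) weight G e * (a * pair_op e f S + b * swap_op e f S).

Lemma split_cone_token_op (R : realType) (V : finType) (G : wgraph R V)
    (c a b : R) (f : {set V} -> R) :
  0 <= c -> 0 <= a -> 0 <= b -> split_cone f -> split_cone (token_op G c a b f).
Proof.
move=> c0 a0 b0 Cf.
apply: SplitConeAdd (split_cone_scale c0 Cf) _ (fun=> erefl).
apply: split_cone_sum => e eG; apply: split_cone_scale; first exact: weight_ge0.
have e2 := edges_card2 eG.
apply: SplitConeAdd (fun=> erefl); apply: split_cone_scale => //.
  exact: split_cone_pair.
exact: split_cone_swap.
Qed.

Lemma walk_sum_iter (R : realType) (V : finType) (k : nat)
    (N : 'M[R]_#|ksubsets V k|) (H : ({set V} -> R) -> {set V} -> R) (t : nat) :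
  (forall f i, \sum_j N i j * f (enum_val j) = H f (enum_val i)) ->
  \sum_i \sum_j (N ^+ t) i j = \sum_(S in ksubsets V k) iter t H (fun=> 1) S.
Proof.
move=> NH; rewrite [RHS]big_enum_val; apply: eq_bigr => i _.
elim: t i => [|t IH] i /=.
  rewrite expr0 (bigD1 i) //= mxE eqxx big1 ?addr0 // => j ji.
  by rewrite mxE eq_sym (negPf ji).
rewrite -NH exprS; under eq_bigr do rewrite mxE.
by rewrite exchange_big; apply: eq_bigr => l _; rewrite -mulr_sumr IH.
Qed.

Lemma symdiffC (V : finType) (S T : {set V}) : symdiff S T = symdiff T S.
Proof. by rewrite /symdiff finset.setUC. Qed.

Lemma symdiffK (V : finType) (S : {set V}) : involutive (symdiff S).
Proof.
by move=> T; apply/setP => v; rewrite !inE; case: (v \in S); case: (v \in T).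
Qed.

Lemma card_symdiff (V : finType) (S T : {set V}) :
  (#|symdiff S T| + 2 * #|S :&: T| = #|S| + #|T|)%N.
Proof.
rewrite /symdiff cardsU (_ : _ :&: (T :\: S) = finset.set0) ?cards0; last first.
  by apply/setP => v; rewrite !inE; case: (v \in S); case: (v \in T).
by have := cardsID T S; have := cardsID S T; rewrite [T :&: S]finset.setIC; lia.
Qed.

Lemma token_adj_action (R : realType) (V : finType) (G : wgraph R V) (k : nat)
    (f : {set V} -> R) (i : 'I_#|ksubsets V k|) :
  \sum_j token_adj G k i j * f (enum_val j) =
  \sum_(e in edges G | #|enum_val i :&: e| == 1%N)
     weight G e * f (symdiff (enum_val i) e).
Proof.
have := enum_valP i; set S := enum_val i; rewrite inE => /eqP Sk.
pose w T := let e := symdiff S T in if e \in edges G then weight G e else 0.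
transitivity (\sum_(T in ksubsets V k) w T * f T).
  by rewrite [RHS]big_enum_val; apply: eq_bigr => j _; rewrite mxE.
(* Index neighbours [T] by the edge [e = symdiff S T]. As [e] has two elements, [T] has size [k]
   exactly when [e] meets [S] in one point. *)
rewrite (reindex_inj (inv_inj (symdiffK S))) /=.
rewrite (eq_bigr (fun e => if e \in edges G
    then weight G e * f (symdiff S e) else 0)); last first.
  by move=> e _; rewrite /w symdiffK; case: ifP; rewrite ?mul0r.
rewrite -big_mkcondr; apply: eq_bigl => e; rewrite andbC.
have [eG /=|//] := boolP (e \in edges G); rewrite inE.
have := card_symdiff S e; rewrite (edges_card2 eG) Sk => E.
by apply/eqP/eqP; lia.
Qed.

Lemma sum_scalar_mx_row (R : pzRingType) (n : nat) (x : R) (g : 'I_n -> R) (i : 'I_n) :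
  \sum_j (x%:M : 'M_n) i j * g j = x * g i.
Proof.
rewrite (bigD1 i) //= big1 ?addr0 => [|j ji]; first by rewrite mxE eqxx mulr1n.
by rewrite mxE eq_sym (negPf ji) mulr0n mul0r.
Qed.

Lemma token_signless_action (R : realType) (V : finType) (G : wgraph R V)
    (k : nat) (x : R) (f : {set V} -> R) (i : 'I_#|ksubsets V k|) :
  \sum_j (token_signless G k + x%:M) i j * f (enum_val j) =
  token_op G x 1 0 f (enum_val i).
Proof.
rewrite /token_signless; under eq_bigr => j _ do rewrite 2!mxE !mulrDl.
rewrite !big_split /= token_adj_action /token_op addrC; congr (_ + _).
  exact: sum_scalar_mx_row.
rewrite (bigD1 i) //= big1 ?addr0 => [|j ji]; last first.
  by rewrite mxE eq_sym (negPf ji) mulr0n mul0r.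
rewrite !mxE eqxx mulr1n /token_deg mulr_suml -big_split /= big_mkcondr.
apply: eq_bigr => e _; rewrite /pair_op mul1r mul0r addr0.
by case: ifP; rewrite ?mulr0 // mulrDr.
Qed.

(* Per edge, adjacency is half of (pair + swap) minus half of the identity. *)
Lemma token_adj_shift_action (R : realType) (V : finType) (G : wgraph R V)
    (k : nat) (x : R) (f : {set V} -> R) (i : 'I_#|ksubsets V k|) :
  \sum_j (token_adj G k + x%:M) i j * f (enum_val j) =
  token_op G (x - (\sum_(e in edges G) weight G e) / 2) 2^-1 2^-1 f (enum_val i).
Proof.
under eq_bigr => j _ do rewrite mxE mulrDl.
rewrite big_split /= token_adj_action /token_op mulrBl.
rewrite sum_scalar_mx_row addrC -addrA; congr (_ + _).
rewrite -mulrA mulr_suml addrC -sumrB big_mkcondr; apply: eq_bigr => e _.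
by rewrite /pair_op /swap_op; case: ifP => _; field.
Qed.

Lemma token_adj_sym (R : realType) (V : finType) (G : wgraph R V) (k : nat) :
  (token_adj G k)^T = token_adj G k.
Proof. by apply/matrixP => i j; rewrite !mxE /= symdiffC. Qed.

Lemma token_adj_ge0 (R : realType) (V : finType) (G : wgraph R V) (k : nat) i j :
  0 <= token_adj G k i j.
Proof. by rewrite mxE /=; case: ifP => // eG; exact: weight_ge0. Qed.

Lemma ksubsets_card_gt0 (V : finType) (k : nat) :
  (k <= #|V|)%N -> (0 < #|ksubsets V k|)%N.
Proof. by move=> kV; rewrite /ksubsets card_draws bin_gt0. Qed.

Theorem corollary6p1 (R : realType) (V : finType) (G : wgraph R V) (k : nat)
    (k_ge1 : (1 <= k)%N) (k_lt : (2 * k < #|V|)%N) :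
  lambda_max (token_signless G k) <= lambda_max (token_signless G k.+1) /\
  lambda_max (token_adj G k) <= lambda_max (token_adj G k.+1).
Proof.
have kgt0 : (0 < #|ksubsets V k|)%N by apply: ksubsets_card_gt0; lia.
have k1gt0 : (0 < #|ksubsets V k.+1|)%N by apply: ksubsets_card_gt0; lia.
have x_ge0 n (x : R) (i j : 'I_n) : 0 <= x -> 0 <= (x%:M : 'M_n) i j.
  by move=> x0; rewrite mxE; case: eqP.
have iter_le c a b t : 0 <= c -> 0 <= a -> 0 <= b ->
    \sum_(S in ksubsets V k) iter t (token_op G c a b) (fun=> 1) S <=
    \sum_(S in ksubsets V k.+1) iter t (token_op G c a b) (fun=> 1) S.
  move=> c0 a0 b0; apply: split_cone_level_le => //.
  elim: t => [|t IH]; first exact: split_cone_const.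
  exact: split_cone_token_op.
split.
  have Qsym l : (token_signless G l)^T = token_signless G l.
    by rewrite /token_signless linearD /= tr_diag_mx token_adj_sym.
  apply: (@lambda_max_le_walk_sum _ _ _ _ _ 0) => // [x x0 i j|x t x0].
    rewrite /token_signless 2!mxE !addr_ge0 ?token_adj_ge0 ?x_ge0 //.
    rewrite mxE; case: eqP => // _; rewrite mulr1n mxE sumr_ge0 // => e /andP[eG _].
    exact: weight_ge0.
  rewrite !(walk_sum_iter _ (token_signless_action G x)).
  exact: iter_le.
have W0 : 0 <= \sum_(e in edges G) weight G e.
  by apply: sumr_ge0 => e eG; exact: weight_ge0.
(* Half the total weight is the least shift keeping the coefficient of the identity in [token_op]
   nonnegative, as cone invariance requires. *)
apply: (lambda_max_le_walk_sum (s := (\sum_(e in edges G) weight G e) / 2)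
  kgt0 k1gt0 (token_adj_sym G k) (token_adj_sym G k.+1)) => [x x0 i j|x t x0].
  rewrite mxE addr_ge0 ?token_adj_ge0 ?x_ge0 //.
  by apply: le_trans x0; rewrite divr_ge0.
rewrite !(walk_sum_iter _ (token_adj_shift_action G x)).
by apply: iter_le; rewrite ?subr_ge0 ?invr_ge0.
Qed.
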